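(* (The $2\to2$ move of the bias $1/10$ game.) Let $\Gamma_1,\Gamma_2,y_0'$ be real numbers with $0<y_0'<\min(\Gamma_1,\Gamma_2)$ and let $f(y)=(y_0'-y)(\Gamma_1-y)(\Gamma_2-y)$. For $\delta>0$ write $y_{(m)}=y_0'+(m+2)\delta$ (so that $f(y_{(-2)})=0$) and set $$x_{g_1}=0,\quad x_{g_2}=y_{(1)},\quad x_{h_1}=y_{(-1)},\quad x_{h_2}=y_{(2)},$$ $$p_{g_1}=\frac{f(0)\,\delta}{y_{(2)}y_{(1)}y_{(-1)}y_{(-2)}},\quad p_{g_2}=\frac{-f(y_{(1)})}{6\,\delta^2y_{(1)}},\quad p_{h_1}=\frac{-f(y_{(-1)})}{6\,\delta^2y_{(-1)}},\quad p_{h_2}=\frac{-f(y_{(2)})}{12\,\delta^2y_{(2)}}.$$ Let $|g_1\rangle,|g_2\rangle,|h_1\rangle,|h_2\rangle$ be orthonormal, $N_g=\sqrt{p_{g_1}+p_{g_2}}$, $N_h=\sqrt{p_{h_1}+p_{h_2}}$, and $$|v\rangle=\tfrac1{N_g}(\sqrt{p_{g_1}}|g_1\rangle+\sqrt{p_{g_2}}|g_2\rangle),\quad |v_1\rangle=\tfrac1{N_g}(\sqrt{p_{g_2}}|g_1\rangle-\sqrt{p_{g_1}}|g_2\rangle),$$ $$|w\rangle=\tfrac1{N_h}(\sqrt{p_{h_1}}|h_1\rangle+\sqrt{p_{h_2}}|h_2\rangle),\quad |w_1\rangle=\tfrac1{N_h}(\sqrt{p_{h_2}}|h_1\rangle-\sqrt{p_{h_1}}|h_2\rangle).$$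 Then for all sufficiently small $\delta>0$ the number $$\beta=\sqrt{\frac{p_{h_1}p_{h_2}}{p_{g_1}p_{g_2}}}\;\frac{x_{h_1}-x_{h_2}}{x_{g_1}-x_{g_2}}$$ satisfies $\beta\le1$, and, for real $\alpha$ with $\alpha^2+\beta^2=1$, the unitary $$U=|w\rangle\langle v|+(\alpha|v\rangle+\beta|w_1\rangle)\langle v_1|+|v_1\rangle\langle w|+(\beta|v\rangle-\alpha|w_1\rangle)\langle w_1|$$ satisfies $U|v\rangle=|w\rangle$ and $$\sum_{i=1}^2x_{h_i}|h_i\rangle\langle h_i|-\sum_{i=1}^2x_{g_i}E_hU|g_i\rangle\langle g_i|U^\dagger E_h\ge0,\qquad E_h=|h_1\rangle\langle h_1|+|h_2\rangle\langle h_2|.$$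
   Context: Matrix inequalities are in the positive semidefinite order. All vectors live in the 4-dimensional space spanned by $|g_1\rangle,|g_2\rangle,|h_1\rangle,|h_2\rangle$. For sufficiently small $\delta$ all the weights $p_{g_i},p_{h_i}$ are positive. *)

(* Defs.v *)
From mathcomp Require Import all_boot all_order all_algebra.
From mathcomp Require Import reals complex.
Set Implicit Arguments.
Unset Strict Implicit.
Unset Printing Implicit Defensive.
Import Order.TTheory GRing.Theory Num.Theory.
Local Open Scope ring_scope.
Local Open Scope sesquilinear_scope.
Local Open Scope complex_scope.

(* Kets are column vectors and <u| is the conjugate transpose of |u>, so that
   the form below is antilinear in u. *)
Definition braket (C : numClosedFieldType) (n : nat) (u v : 'cV[C]_n) : C :=
  (u ^t* *m v) 0 0.

(* |u><v| *)
Definition ketbra (C : numClosedFieldType) (n : nat) (u v : 'cV[C]_n) : 'M[C]_n :=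
  u *m v ^t*.

Definition orthonormal_kets (C : numClosedFieldType) (n : nat) (s : seq 'cV[C]_n) : Prop :=
  forall i j : nat, (i < size s)%N -> (j < size s)%N ->
    braket s`_i s`_j = (i == j)%:R.

(* A >= 0 in the positive semidefinite order. *)
Definition psdmx (C : numClosedFieldType) (n : nat) (A : 'M[C]_n) : Prop :=
  A ^t* = A /\ forall u : 'cV[C]_n, 0 <= braket u (A *m u).

Definition fpoly (R : realType) (Gamma1 Gamma2 y0 y : R) : R :=
  (y0 - y) * (Gamma1 - y) * (Gamma2 - y).

(* The point y_(m); the shift by 2 makes y_(-2) = y0 a root of fpoly. *)
Definition gridpt (R : realType) (y0 delta : R) (m : int) : R :=
  y0 + (m + 2)%:~R * delta.

(* Main.v *)
Require Import Defs.
From mathcomp Require Import all_boot all_order all_algebra.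
From mathcomp Require Import reals complex.
From mathcomp Require Import ring lra.
Set Implicit Arguments.
Unset Strict Implicit.
Unset Printing Implicit Defensive.
Import Order.TTheory GRing.Theory Num.Theory.
Local Open Scope ring_scope.
Local Open Scope sesquilinear_scope.

(* Write a = E_h U |g2>. Since x_{g1} = 0, the operator in the theorem is
   X_h - x_{g2} |a><a| with a = (sqrt p_{g2} |w> - beta sqrt p_{g1} |w1>) / N_g.
   The value of beta is exactly the one that cancels the off-diagonal entries in
   the basis |w>, |w1>, so positivity reduces to two real numbers: the
   |w><w| entry is delta / N_h^2, and the |w1><w1| entry is positive because
   p_{g1} is of order delta while p_{h1} is of order 1/delta.
   With q(y) = (Gamma1 - y)(Gamma2 - y) one finds
   beta^2 = q(y_(-1)) q(y_(2)) / (q(0) q(y_(1))), which is at most 1 as q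
   decreases on [0, min(Gamma1, Gamma2)]. Everything holds as soon as
   y_(2) < min(Gamma1, Gamma2). *)

(** * Bra-ket algebra, orthonormal families and rank-one positivity *)

Section Kets.
Variables (C : numClosedFieldType) (n : nat).
Implicit Types (u v w : 'cV[C]_n) (A B : 'M[C]_n).

Lemma ketbraE u v i j : ketbra u v i j = u i 0 * (v j 0)^*.
Proof. by rewrite mxE big_ord1 !mxE. Qed.

Lemma braketE u v : braket u v = \sum_i (u i 0)^* * v i 0.
Proof. by rewrite /braket mxE; apply: eq_bigr => i _; rewrite !mxE. Qed.

Lemma conj_braket u v : (braket u v)^* = braket v u.
Proof.
rewrite !braketE rmorph_sum; apply: eq_bigr => i _ /=.
by rewrite rmorphM /= conjCK mulrC.
Qed.

Lemma braketDr u v w : braket u (v + w) = braket u v + braket u w.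
Proof. by rewrite /braket mulmxDr mxE. Qed.

Lemma braketNr u v : braket u (- v) = - braket u v.
Proof. by rewrite /braket mulmxN mxE. Qed.

Lemma braketZr (a : C) u v : braket u (a *: v) = a * braket u v.
Proof. by rewrite /braket -scalemxAr mxE. Qed.

Lemma braketDl u v w : braket (u + v) w = braket u w + braket v w.
Proof. by rewrite -conj_braket braketDr rmorphD /= !conj_braket. Qed.

Lemma braketNl u v : braket (- u) v = - braket u v.
Proof. by rewrite -conj_braket braketNr rmorphN /= !conj_braket. Qed.

Lemma braketZl (a : C) u v : braket (a *: u) v = a^* * braket u v.
Proof. by rewrite -conj_braket braketZr rmorphM /= !conj_braket. Qed.

Lemma ketbra_ket u v w : ketbra u v *m w = braket v w *: u.
Proof.
rewrite /ketbra -mulmxA; apply/matrixP => i j.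
by rewrite !ord1 [LHS]mxE big_ord1 [RHS]mxE mulrC.
Qed.

Lemma ketbra_adj u v : (ketbra u v)^t* = ketbra v u.
Proof. by apply/matrixP => i j; rewrite !mxE !big_ord1 !mxE rmorphM /= conjCK mulrC. Qed.

Lemma mulmx_adj A B : (A *m B)^t* = B^t* *m A^t*.
Proof. by rewrite trmx_mul map_mxM. Qed.

Lemma ketbra_conjugate A u v : A *m ketbra u v *m A^t* = ketbra (A *m u) (A *m v).
Proof. by rewrite /ketbra trmx_mul map_mxM !mulmxA. Qed.

(** The form at [w] equals a |<w|u>|^2 + b |<w|v>|^2. *)
Lemma psd_ketbraD (a b : C) u v :
  0 <= a -> 0 <= b -> psdmx (a *: ketbra u u + b *: ketbra v v).
Proof.
move=> a0 b0; split.
  apply/matrixP => i j; rewrite !mxE !big_ord1 !mxE rmorphD /= !rmorphM /= !conjCK.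
  rewrite !(conj_Creal (ger0_real a0)) !(conj_Creal (ger0_real b0)); ring.
move=> w; rewrite mulmxDl -!scalemxAl !ketbra_ket braketDr !braketZr.
by rewrite -(conj_braket w u) -(conj_braket w v) !(mulrC (_^*))
  -!normCK addr_ge0 ?mulr_ge0 ?exprn_ge0.
Qed.

(** The matrix [P] with columns [s] is square, so its left inverse [P^t*] is also a right inverse,
    and [P *m P^t*] is the sum of projectors. *)
Lemma orthonormal_complete (s : seq 'cV[C]_n) :
  orthonormal_kets s -> size s = n ->
  \sum_(j < n) ketbra s`_j s`_j = 1%:M.
Proof.
move=> os ss.
pose P : 'M[C]_n := \matrix_(i, j) (s`_j) i 0.
have PP : P^t* *m P = 1%:M.
  apply/matrixP => i j; rewrite mxE.
  under eq_bigr => k _ do rewrite !mxE.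
  by rewrite -braketE os ?ss // mxE.
rewrite -(mulmx1C PP); apply/matrixP => i j; rewrite summxE mxE.
by apply: eq_bigr => k _; rewrite ketbraE !mxE.
Qed.

(** Orthonormality of [s] collapses the product with the adjoint to the sum of the [ketbra t_j t_j],
    and [t] is complete. *)
Lemma orthonormal_map (s t : seq 'cV[C]_n) :
  orthonormal_kets s -> orthonormal_kets t -> size s = n -> size t = n ->
  \sum_(j < n) ketbra t`_j s`_j \is unitarymx.
Proof.
move=> os ot ss st; apply/unitarymxP; rewrite -(orthonormal_complete ot st).
rewrite raddf_sum rmorph_sum /= mulmx_sumr; apply: eq_bigr => j _.
rewrite ketbra_adj /ketbra mulmxA mulmx_suml; congr (_ *m _).
rewrite (bigD1 j) //= big1 ?addr0 => [|i ij].
  by rewrite ketbra_ket os ?ss // eqxx scale1r.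
have ij' : (i == j :> nat) = false by exact: negPf ij.
by rewrite ketbra_ket os ?ss // ij' scale0r.
Qed.

(** Permuting the list brings any pair to the front, where [orthonormal_rot] acts. *)
Lemma orthonormal_reindex (s : seq 'cV[C]_n) (p : seq nat) :
  orthonormal_kets s -> uniq p -> all (fun i => (i < size s)%N) p ->
  orthonormal_kets [seq s`_i | i <- p].
Proof.
move=> os up /allP sp i j; rewrite size_map => ip jp.
by rewrite !(nth_map 0%N) // os ?sp ?mem_nth // nth_uniq.
Qed.

Lemma orthonormal4 (a b c d : 'cV[C]_n) :
  [/\ braket a a = 1, braket b b = 1, braket c c = 1 & braket d d = 1] ->
  [/\ braket a b = 0, braket a c = 0 & braket a d = 0] ->
  [/\ braket b c = 0, braket b d = 0 & braket c d = 0] ->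
  orthonormal_kets [:: a; b; c; d].
Proof.
move=> [aa bb cc dd] [ab ac ad] [bc bd cd].
have sym u v : braket u v = 0 -> braket v u = 0.
  by move=> uv; rewrite -conj_braket uv rmorph0.
by move=> [|[|[|[|i]]]] [|[|[|[|j]]]] //= _ _; rewrite ?(sym _ _ ab) ?(sym _ _ ac)
  ?(sym _ _ ad) ?(sym _ _ bc) ?(sym _ _ bd) ?(sym _ _ cd).
Qed.

Lemma orthonormal_rot (a b : C) (g1 g2 h1 h2 : 'cV[C]_n) :
  a^* = a -> b^* = b -> a ^+ 2 + b ^+ 2 = 1 ->
  orthonormal_kets [:: g1; g2; h1; h2] ->
  orthonormal_kets [:: a *: g1 + b *: g2; b *: g1 - a *: g2; h1; h2].
Proof.
move=> ar br ab os.
have := (os 0 0 isT isT, os 0 1 isT isT, os 0 2 isT isT, os 0 3 isT isT)%N.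
have := (os 1 0 isT isT, os 1 1 isT isT, os 1 2 isT isT, os 1 3 isT isT)%N.
have := (os 2 2 isT isT, os 2 3 isT isT, os 3 3 isT isT)%N.
move=> /= E1 E2 E3.
apply: orthonormal4; split; rewrite ?(braketDl, braketDr, braketNl, braketNr,
  braketZl, braketZr, ar, br) ?(E1, E2, E3) //=;
  first [ring | rewrite -[RHS]ab; ring].
Qed.

(** The matrix with rows (a, b) and (b, -a) is a reflection, hence an involution: the same
    coefficients recover the old pair from the new one. *)
Lemma rot_fst (a b : C) (g1 g2 : 'cV[C]_n) : a ^+ 2 + b ^+ 2 = 1 ->
  a *: (a *: g1 + b *: g2) + b *: (b *: g1 - a *: g2) = g1.
Proof.
move=> ab; rewrite -[RHS]scale1r -ab.
by apply/matrixP => i j; rewrite !mxE; ring.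
Qed.

Lemma rot_snd (a b : C) (g1 g2 : 'cV[C]_n) : a ^+ 2 + b ^+ 2 = 1 ->
  b *: (a *: g1 + b *: g2) - a *: (b *: g1 - a *: g2) = g2.
Proof.
move=> ab; rewrite -[RHS]scale1r -ab.
by apply/matrixP => i j; rewrite !mxE; ring.
Qed.

(** The three scalar hypotheses concern the entries of the operator on [w], [w1]: two diagonal ones
    and the off-diagonal one, whose vanishing leaves a nonnegative sum of two projectors. *)
Lemma psd_two_level (x1 x2 x a b c e : C) (w w1 : 'cV[C]_n) :
  a^* = a -> b^* = b -> c^* = c -> e^* = e ->
  0 <= x1 * a ^+ 2 + x2 * b ^+ 2 - x * c ^+ 2 ->
  x1 * a * b - x2 * a * b + x * c * e = 0 ->
  0 <= x1 * b ^+ 2 + x2 * a ^+ 2 - x * e ^+ 2 ->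
  psdmx (x1 *: ketbra (a *: w + b *: w1) (a *: w + b *: w1)
    + x2 *: ketbra (b *: w - a *: w1) (b *: w - a *: w1)
    - x *: ketbra (c *: w - e *: w1) (c *: w - e *: w1)).
Proof.
move=> ar br cr er ww cross w1w1.
suff -> : x1 *: ketbra (a *: w + b *: w1) (a *: w + b *: w1)
    + x2 *: ketbra (b *: w - a *: w1) (b *: w - a *: w1)
    - x *: ketbra (c *: w - e *: w1) (c *: w - e *: w1) =
    (x1 * a ^+ 2 + x2 * b ^+ 2 - x * c ^+ 2) *: ketbra w w
    + (x1 * b ^+ 2 + x2 * a ^+ 2 - x * e ^+ 2) *: ketbra w1 w1.
  exact: psd_ketbraD.
(* The vanishing off-diagonal part is added back, making the claim a polynomial identity. *)
rewrite -[RHS]addr0 -(scale0r (ketbra w w1 + ketbra w1 w)) -cross.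
apply/matrixP => i j; rewrite !(ketbraE, mxE) !(rmorphB, rmorphD, rmorphM) /=.
by rewrite !(ar, br, cr, er); ring.
Qed.

Lemma conj_ketbra_proj (E U : 'M[C]_n) (g : 'cV[C]_n) : E^t* = E ->
  E *m U *m ketbra g g *m U^t* *m E = ketbra (E *m (U *m g)) (E *m (U *m g)).
Proof.
move=> Eh; rewrite !mulmxA -(ketbra_conjugate (E *m U)) mulmx_adj Eh.
by rewrite !mulmxA.
Qed.

End Kets.

Local Open Scope complex_scope.

Lemma conjC_rc (R : realType) (x : R) : Num.conj (x%:C) = x%:C :> R[i].
Proof. by rewrite conj_Creal ?complex_real. Qed.

(* [quad m] is (Gamma1 - y)(Gamma2 - y) at y = y_(m-2); in the weights below the
   root y0 of f has been cancelled against the denominators. *)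
Definition quad (R : realType) (G1 G2 y0 d m : R) : R :=
  (G1 - (y0 + m * d)) * (G2 - (y0 + m * d)).
Definition wg1 (R : realType) (G1 G2 y0 d : R) : R :=
  G1 * G2 * d / ((y0 + 4 * d) * (y0 + 3 * d) * (y0 + d)).
Definition wg2 (R : realType) (G1 G2 y0 d : R) : R :=
  quad G1 G2 y0 d 3 / (2 * d * (y0 + 3 * d)).
Definition wh1 (R : realType) (G1 G2 y0 d : R) : R :=
  quad G1 G2 y0 d 1 / (6 * d * (y0 + d)).
Definition wh2 (R : realType) (G1 G2 y0 d : R) : R :=
  quad G1 G2 y0 d 4 / (3 * d * (y0 + 4 * d)).

(** * Positivity, moments and bounds of the weights *)

Section Weights.
Variables (R : realType) (G1 G2 y0 d : R).
Hypotheses (y0_gt0 : 0 < y0) (d_gt0 : 0 < d)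
  (hG1 : y0 + 4 * d < G1) (hG2 : y0 + 4 * d < G2).
Local Notation q := (quad G1 G2 y0 d).
Local Notation pg1 := (wg1 G1 G2 y0 d).
Local Notation pg2 := (wg2 G1 G2 y0 d).
Local Notation ph1 := (wh1 G1 G2 y0 d).
Local Notation ph2 := (wh2 G1 G2 y0 d).

Lemma quad_gt0 m : m <= 4 -> 0 < q m.
Proof.
move: y0_gt0 d_gt0 hG1 hG2 => y0p dp G1p G2p.
move=> m4; have h : m * d <= 4 * d by rewrite ler_wpM2r // ltW.
by apply: mulr_gt0; lra.
Qed.

Lemma quad_le m m' : m <= m' -> m' <= 4 -> q m' <= q m.
Proof.
move: y0_gt0 d_gt0 hG1 hG2 => y0p dp G1p G2p.
move=> mm m4.
have h : m' * d <= 4 * d by rewrite ler_wpM2r // ltW.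
have h' : m * d <= m' * d by rewrite ler_wpM2r // ltW.
by apply: ler_pM; lra.
Qed.

Lemma quad_le_prod m : 0 <= m -> m <= 4 -> q m <= G1 * G2.
Proof.
move: y0_gt0 d_gt0 hG1 hG2 => y0p dp G1p G2p.
move=> m0 m4.
have h : m * d <= 4 * d by rewrite ler_wpM2r // ltW.
have h' : 0 <= m * d by rewrite mulr_ge0 // ltW.
by apply: ler_pM; lra.
Qed.

Lemma weights_gt0 : [/\ 0 < pg1, 0 < pg2, 0 < ph1 & 0 < ph2].
Proof.
move: y0_gt0 d_gt0 hG1 hG2 => y0p dp G1p G2p.
have ? : 0 < G1 by lra.
have ? : 0 < G2 by lra.
have ? : 0 < y0 + d by lra.
have ? : 0 < y0 + 3 * d by lra.
have ? : 0 < y0 + 4 * d by lra.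
have ? : 0 < q 1 by apply: quad_gt0; lra.
have ? : 0 < q 3 by apply: quad_gt0; lra.
have ? : 0 < q 4 by apply: quad_gt0; lra.
split; rewrite divr_gt0 ?mulr_gt0 ?ltr0n //; lra.
Qed.

(* This and the next lemma are the divided differences of f and y * f over the
   nodes 0, y_(-2), y_(-1), y_(1), y_(2): as f = - y^3 + ..., they are 0 and -1. *)
Lemma weights_sum : pg1 + pg2 = ph1 + ph2.
Proof.
move: y0_gt0 d_gt0 hG1 hG2 => y0p dp G1p G2p.
rewrite /wg1 /wg2 /wh1 /wh2 /quad; field.
by rewrite !gt_eqF //; lra.
Qed.

Lemma weights_mean :
  (y0 + d) * ph1 + (y0 + 4 * d) * ph2 - (y0 + 3 * d) * pg2 = d.
Proof.
move: y0_gt0 d_gt0 hG1 hG2 => y0p dp G1p G2p.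
rewrite /wg2 /wh1 /wh2 /quad; field.
by rewrite !gt_eqF //; lra.
Qed.

(** The squared ratio is that of x_{h1} - x_{h2} to x_{g1} - x_{g2}, so the left side is beta^2.
    Here [G1 * G2] is (Gamma1 - y)(Gamma2 - y) at y = 0, whereas [q 0] would be its value at y0. *)
Lemma beta_sqE :
  ph1 * ph2 / (pg1 * pg2) * (3 * d / (y0 + 3 * d)) ^+ 2
  = q 1 * q 4 / (G1 * G2 * q 3).
Proof.
move: y0_gt0 d_gt0 hG1 hG2 => y0p dp G1p G2p.
have : q 3 != 0 by rewrite gt_eqF // quad_gt0 //; lra.
rewrite /wg1 /wg2 /wh1 /wh2; move: (q 3) (q 1) (q 4) => a b c a0.
field; rewrite a0 /=.
by rewrite !gt_eqF //; lra.
Qed.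

(** The factors pair off: [q 4 <= q 3] and [q 1 <= G1 * G2]. *)
Lemma beta_sq_le1 : ph1 * ph2 / (pg1 * pg2) * (3 * d / (y0 + 3 * d)) ^+ 2 <= 1.
Proof.
move: y0_gt0 d_gt0 hG1 hG2 => y0p dp G1p G2p.
have q3 : 0 < q 3 by apply: quad_gt0; lra.
have q4 : 0 < q 4 by apply: quad_gt0; lra.
have q1 : 0 < q 1 by apply: quad_gt0; lra.
have q43 : q 4 <= q 3 by apply: quad_le; lra.
have q1G : q 1 <= G1 * G2 by apply: quad_le_prod; lra.
rewrite beta_sqE ler_pdivrMr ?mul1r ?mulr_gt0 //; try lra.
by apply: ler_pM => //; apply: ltW.
Qed.

(* The bounded quantity is N_h^2 times the coefficient of |w1><w1| in the
   operator of the theorem. *)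
Lemma wperp_coef_ge0 :
  0 <= (y0 + d) * ph2 + (y0 + 4 * d) * ph1
     - (y0 + 3 * d) * pg1 * (ph1 * ph2 / (pg1 * pg2) * (3 * d / (y0 + 3 * d)) ^+ 2).
Proof.
move: y0_gt0 d_gt0 hG1 hG2 => y0p dp G1p G2p.
have [pg1_gt0 pg2_gt0 ph1_gt0 ph2_gt0] := weights_gt0.
have q3 : 0 < q 3 by apply: quad_gt0; lra.
have q1 : 0 < q 1 by apply: quad_gt0; lra.
have q43 : q 4 <= q 3 by apply: quad_le; lra.
(* Factoring out [ph1] makes the subtracted term comparable with [(y0 + 4 * d) * ph1]. *)
have -> : (y0 + 3 * d) * pg1 * (ph1 * ph2 / (pg1 * pg2) * (3 * d / (y0 + 3 * d)) ^+ 2)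
   = ph1 * (6 * d ^+ 2 / (y0 + 4 * d)) * (q 4 / q 3).
  rewrite beta_sqE /wg1 /wh1; move: (q 3) (q 1) (q 4) q3 => a b c a0.
  by field; rewrite !gt_eqF //; lra.
have r1 : q 4 / q 3 <= 1 by rewrite ler_pdivrMr // mul1r.
have k0 : 0 <= 6 * d ^+ 2 / (y0 + 4 * d).
  by rewrite divr_ge0 // ?mulr_ge0 ?exprn_ge0 //; lra.
(* The square of y0 + 4d already contains 16 d^2. *)
have k1 : 6 * d ^+ 2 / (y0 + 4 * d) <= y0 + 4 * d.
  rewrite ler_pdivrMr; last by lra.
  nra.
have : ph1 * (6 * d ^+ 2 / (y0 + 4 * d)) * (q 4 / q 3) <= ph1 * (y0 + 4 * d).
  rewrite -mulrA ler_pM2l //; apply: le_trans k1.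
  by rewrite ler_piMr.
have : 0 <= (y0 + d) * ph2 by rewrite mulr_ge0 ?addr_ge0 // ltW.
lra.
Qed.
End Weights.

(** * The operator inequality for abstract weights *)

Lemma sqrt_normalized (R : realType) (p1 p2 : R) : 0 < p1 -> 0 < p2 ->
  (Num.sqrt p1 / Num.sqrt (p1 + p2)) ^+ 2
  + (Num.sqrt p2 / Num.sqrt (p1 + p2)) ^+ 2 = 1.
Proof.
move=> p1_gt0 p2_gt0; rewrite !exprMn !exprVn !sqr_sqrtr; try lra.
by rewrite -mulrDl divff // gt_eqF //; lra.
Qed.

(** This isolates the linear algebra from the explicit weights, which enter only through scalar
    relations. The choice x_{g1} = 0 is built in: hence [0 - x] in [beta] and a single [g2] term in
    the operator. *)
Lemma two_to_two_move (R : realType) (pg1 pg2 ph1 ph2 x xh1 xh2 alpha : R)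
    (g1 g2 h1 h2 : 'cV[R[i]]_4) :
  let Ng := Num.sqrt (pg1 + pg2) in
  let Nh := Num.sqrt (ph1 + ph2) in
  let beta := Num.sqrt ((ph1 * ph2) / (pg1 * pg2)) * ((xh1 - xh2) / (0 - x)) in
  let v := (1 / Ng)%:C *: ((Num.sqrt pg1)%:C *: g1 + (Num.sqrt pg2)%:C *: g2) in
  let v1 := (1 / Ng)%:C *: ((Num.sqrt pg2)%:C *: g1 - (Num.sqrt pg1)%:C *: g2) in
  let w := (1 / Nh)%:C *: ((Num.sqrt ph1)%:C *: h1 + (Num.sqrt ph2)%:C *: h2) in
  let w1 := (1 / Nh)%:C *: ((Num.sqrt ph2)%:C *: h1 - (Num.sqrt ph1)%:C *: h2) in
  let Eh := ketbra h1 h1 + ketbra h2 h2 in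
  let U := ketbra w v + ketbra (alpha%:C *: v + beta%:C *: w1) v1
           + ketbra v1 w + ketbra (beta%:C *: v - alpha%:C *: w1) w1 in
  0 < pg1 -> 0 < pg2 -> 0 < ph1 -> 0 < ph2 -> x != 0 ->
  pg1 + pg2 = ph1 + ph2 ->
  0 <= xh1 * ph1 + xh2 * ph2 - x * pg2 ->
  0 <= xh1 * ph2 + xh2 * ph1 - x * pg1 * beta ^+ 2 ->
  alpha ^+ 2 + beta ^+ 2 = 1 ->
  orthonormal_kets [:: g1; g2; h1; h2] ->
  [/\ U \is unitarymx,
      U *m v = w &
      psdmx ((xh1%:C *: ketbra h1 h1 + xh2%:C *: ketbra h2 h2)
            - x%:C *: (Eh *m U *m ketbra g2 g2 *m U ^t* *m Eh))].
Proof.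
move=> Ng Nh beta v v1 w w1 Eh U pg1_gt0 pg2_gt0 ph1_gt0 ph2_gt0 x_neq0 psum
  ww_ge0 w1w1_ge0 ab os.
have NhE : Nh = Ng by rewrite /Nh -psum.
have N2 : Ng ^+ 2 = pg1 + pg2 by rewrite sqr_sqrtr; lra.
have Ng_neq0 : Ng != 0 by rewrite gt_eqF // sqrtr_gt0; lra.
pose e := Num.sqrt pg1 / Ng; pose c := Num.sqrt pg2 / Ng.
pose a := Num.sqrt ph1 / Nh; pose b := Num.sqrt ph2 / Nh.
have ec1 : e%:C ^+ 2 + c%:C ^+ 2 = 1 :> R[i].
  by rewrite -!rmorphXn -rmorphD /= sqrt_normalized.
have ab1 : a%:C ^+ 2 + b%:C ^+ 2 = 1 :> R[i].
  by rewrite -!rmorphXn -rmorphD /= sqrt_normalized.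
have alphabeta1 : alpha%:C ^+ 2 + beta%:C ^+ 2 = 1 :> R[i].
  by rewrite -!rmorphXn -rmorphD /= ab.
have sc (N p : R) (k : 'cV[R[i]]_4) : (1 / N)%:C *: (p%:C *: k) = (p / N)%:C *: k.
  by rewrite scalerA -rmorphM /= mulrAC mul1r mulrC.
have vE : v = e%:C *: g1 + c%:C *: g2 by rewrite /v scalerDr !sc.
have v1E : v1 = c%:C *: g1 - e%:C *: g2 by rewrite /v1 scalerBr !sc.
have wE : w = a%:C *: h1 + b%:C *: h2 by rewrite /w scalerDr !sc.
have w1E : w1 = b%:C *: h1 - a%:C *: h2 by rewrite /w1 scalerBr !sc.
have aE : a = Num.sqrt ph1 / Ng by rewrite -NhE.
have bE : b = Num.sqrt ph2 / Ng by rewrite -NhE.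
have cE : c = Num.sqrt pg2 / Ng by [].
have eE : e = Num.sqrt pg1 / Ng by [].
have betaE : beta =
  Num.sqrt ((ph1 * ph2) / (pg1 * pg2)) * ((xh1 - xh2) / (0 - x)) by [].
(* From here these are atoms, known only through the equations recorded above. *)
clearbody v v1 w w1 a b c e beta.
have g2E : g2 = c%:C *: v - e%:C *: v1 by rewrite vE v1E rot_snd.
have h1E : h1 = a%:C *: w + b%:C *: w1 by rewrite wE w1E rot_fst.
have h2E : h2 = b%:C *: w - a%:C *: w1 by rewrite wE w1E rot_snd.
have osg : orthonormal_kets [:: v; v1; h1; h2].
  by rewrite vE v1E; apply: orthonormal_rot; rewrite ?conjC_rc.
have oss : orthonormal_kets [:: v; v1; w; w1].
  have := orthonormal_reindex (p := [:: 2; 3; 0; 1]%N) osg isT isT.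
  move=> /(@orthonormal_rot _ _ a%:C b%:C); rewrite !conjC_rc -wE -w1E.
  move=> /(_ erefl erefl ab1) o.
  exact: (orthonormal_reindex (p := [:: 2; 3; 0; 1]%N) o isT isT).
(* These are the images of [v], [v1], [w], [w1] under [U], obtained by reflecting the pair [v],
   [w1]. *)
have ost : orthonormal_kets
    [:: w; alpha%:C *: v + beta%:C *: w1; v1; beta%:C *: v - alpha%:C *: w1].
  have := orthonormal_reindex (p := [:: 0; 3; 2; 1]%N) oss isT isT.
  move=> /(@orthonormal_rot _ _ alpha%:C beta%:C); rewrite !conjC_rc.
  move=> /(_ erefl erefl alphabeta1) o.
  exact: (orthonormal_reindex (p := [:: 2; 0; 3; 1]%N) o isT isT).
have := (oss 0 0 isT isT, oss 1 0 isT isT, oss 2 0 isT isT, oss 3 0 isT isT)%N.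
have := (oss 0 1 isT isT, oss 1 1 isT isT, oss 2 1 isT isT, oss 3 1 isT isT)%N.
have := (osg 2 0 isT isT, osg 3 0 isT isT)%N.
have := (os 2 2 isT isT, os 3 2 isT isT, os 2 3 isT isT, os 3 3 isT isT)%N.
move=> /= h_h h_v s_v1 s_v.
have Uv : U *m v = w.
  by rewrite !mulmxDl !ketbra_ket !s_v /= scale1r !scale0r !addr0.
have Uv1 : U *m v1 = alpha%:C *: v + beta%:C *: w1.
  rewrite !mulmxDl !ketbra_ket !s_v1 /= scale1r !scale0r.
  rewrite addr0 addr0 add0r; exact: erefl.
split=> //.
  have := orthonormal_map oss ost erefl erefl.
  by rewrite !big_ord_recr big_ord0 /= add0r.
clearbody U.
have Eh_adj : Eh^t* = Eh by rewrite /Eh raddfD /= map_mxD !ketbra_adj.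
have Ehv : Eh *m v = 0.
  by rewrite mulmxDl !ketbra_ket !h_v /= !scale0r addr0.
have Ehh1 : Eh *m h1 = h1.
  by rewrite mulmxDl !ketbra_ket !h_h /= scale1r scale0r addr0.
have Ehh2 : Eh *m h2 = h2.
  by rewrite mulmxDl !ketbra_ket !h_h /= scale1r scale0r add0r.
clearbody Eh.
have Ehw : Eh *m w = w by rewrite wE mulmxDr -!scalemxAr Ehh1 Ehh2.
have Ehw1 : Eh *m w1 = w1 by rewrite w1E mulmxBr -!scalemxAr Ehh1 Ehh2.
(* The component of [U *m v1] along [v] is killed by [Eh], so [alpha] disappears. *)
have image_g2 : Eh *m (U *m g2) = c%:C *: w - (e * beta)%:C *: w1.
  rewrite g2E mulmxBr -!scalemxAr Uv Uv1 mulmxBr -!scalemxAr mulmxDr -!scalemxAr.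
  rewrite Ehw Ehv Ehw1 scaler0 add0r scalerA.
  rewrite -(rmorphM (real_complex R)); exact: erefl.
rewrite conj_ketbra_proj // image_g2 {1 2}h1E {1 2}h2E.
have sq (p : R) : 0 < p -> (Num.sqrt p / Ng) ^+ 2 = p / Ng ^+ 2.
  by move=> p_gt0; rewrite exprMn exprVn sqr_sqrtr // ltW.
have N2_ge0 : 0 <= (Ng ^+ 2)^-1 by rewrite invr_ge0 sqr_ge0.
apply: psd_two_level; rewrite ?conjC_rc //.
- rewrite -!rmorphXn -!rmorphM -rmorphD -rmorphB /= ler0c.
  rewrite aE bE cE !sq //.
  have := mulr_ge0 ww_ge0 N2_ge0; congr (_ <= _); ring.
(* Off-diagonal entry: the definition of [beta] is the solution of this linear equation. *)
- rewrite -!rmorphM -rmorphB -rmorphD /=; apply/eqP; rewrite fmorph_eq0; apply/eqP.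
  rewrite aE bE cE eE betaE sqrtrM ?sqrtrV ?sqrtrM; try by rewrite ?mulr_ge0 // ltW.
  have := sqrtr_gt0 pg1; have := sqrtr_gt0 pg2; rewrite pg1_gt0 pg2_gt0.
  move=> s2 s1; field.
  by rewrite Ng_neq0 x_neq0 !gt_eqF.
rewrite -!rmorphXn -!rmorphM -rmorphD -rmorphB /= ler0c.
rewrite exprMn aE bE eE !sq //.
have := mulr_ge0 w1w1_ge0 N2_ge0; congr (_ <= _); ring.
Qed.

(** * Specialization to the weights of the game *)

Theorem mainTheorem4 (R : realType) (Gamma1 Gamma2 y0 : R)
    (hy0 : 0 < y0) (hy0Gamma : y0 < Num.min Gamma1 Gamma2) :
  exists2 delta0 : R, 0 < delta0 &
  forall delta : R, 0 < delta < delta0 ->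
  let f := fpoly Gamma1 Gamma2 y0 in
  let y := gridpt y0 delta in
  let xg1 : R := 0 in
  let xg2 : R := y 1 in
  let xh1 : R := y (-1) in
  let xh2 : R := y 2 in
  let pg1 : R := f 0 * delta / (y 2 * y 1 * y (-1) * y (-2)) in
  let pg2 : R := - f (y 1) / (6 * delta ^+ 2 * y 1) in
  let ph1 : R := - f (y (-1)) / (6 * delta ^+ 2 * y (-1)) in
  let ph2 : R := - f (y 2) / (12 * delta ^+ 2 * y 2) in
  let Ng : R := Num.sqrt (pg1 + pg2) in
  let Nh : R := Num.sqrt (ph1 + ph2) in
  let beta : R :=
    Num.sqrt ((ph1 * ph2) / (pg1 * pg2)) * ((xh1 - xh2) / (xg1 - xg2)) in
  beta <= 1 /\
  forall g1 g2 h1 h2 : 'cV[R[i]]_4, orthonormal_kets [:: g1; g2; h1; h2] ->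
  let v := (1 / Ng)%:C *: ((Num.sqrt pg1)%:C *: g1 + (Num.sqrt pg2)%:C *: g2) in
  let v1 := (1 / Ng)%:C *: ((Num.sqrt pg2)%:C *: g1 - (Num.sqrt pg1)%:C *: g2) in
  let w := (1 / Nh)%:C *: ((Num.sqrt ph1)%:C *: h1 + (Num.sqrt ph2)%:C *: h2) in
  let w1 := (1 / Nh)%:C *: ((Num.sqrt ph2)%:C *: h1 - (Num.sqrt ph1)%:C *: h2) in
  let Eh := ketbra h1 h1 + ketbra h2 h2 in
  forall alpha : R, alpha ^+ 2 + beta ^+ 2 = 1 ->
  let U := ketbra w v + ketbra (alpha%:C *: v + beta%:C *: w1) v1
           + ketbra v1 w + ketbra (beta%:C *: v - alpha%:C *: w1) w1 in
  [/\ U \is unitarymx,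
      U *m v = w &
      psdmx ((xh1%:C *: ketbra h1 h1 + xh2%:C *: ketbra h2 h2)
            - (xg1%:C *: (Eh *m U *m ketbra g1 g1 *m U ^t* *m Eh)
               + xg2%:C *: (Eh *m U *m ketbra g2 g2 *m U ^t* *m Eh)))].
Proof.
(* This bound says exactly that y_(2) = y0 + 4 delta stays below both Gammas. *)
exists ((Num.min Gamma1 Gamma2 - y0) / 4) => [|delta /andP[d_gt0 d_lt]].
  by rewrite divr_gt0 // subr_gt0.
have /andP[hG1 hG2] : (y0 + 4 * delta < Gamma1) && (y0 + 4 * delta < Gamma2).
  by rewrite -lt_min; move: d_lt; rewrite ltr_pdivlMr //; lra.
move=> f y xg1 xg2 xh1 xh2 pg1 pg2 ph1 ph2 Ng Nh beta.
have yE m : y m = y0 + (m + 2)%:~R * delta by [].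
have y1E : xg2 = y0 + 3 * delta by [].
have ym1E : xh1 = y0 + delta by rewrite /xh1 yE mul1r.
have y2E : xh2 = y0 + 4 * delta by [].
have y3_neq0 : y0 + 3 * delta != 0 by rewrite gt_eqF //; lra.
have pg1E : pg1 = wg1 Gamma1 Gamma2 y0 delta.
  rewrite /pg1 -/xg2 -/xh1 -/xh2 y1E ym1E y2E yE /f /fpoly /wg1 mul0r addr0.
  by field; rewrite !gt_eqF //; lra.
have pg2E : pg2 = wg2 Gamma1 Gamma2 y0 delta.
  rewrite /pg2 -/xg2 y1E /f /fpoly /wg2 /quad.
  by field; rewrite !gt_eqF //; lra.
have ph1E : ph1 = wh1 Gamma1 Gamma2 y0 delta.
  rewrite /ph1 -/xh1 ym1E /f /fpoly /wh1 /quad.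
  by field; rewrite !gt_eqF //; lra.
have ph2E : ph2 = wh2 Gamma1 Gamma2 y0 delta.
  rewrite /ph2 -/xh2 y2E /f /fpoly /wh2 /quad.
  by field; rewrite !gt_eqF //; lra.
have [] := weights_gt0 hy0 d_gt0 hG1 hG2.
have := weights_sum hy0 d_gt0 hG1 hG2.
have := weights_mean hy0 d_gt0 hG1 hG2.
have := wperp_coef_ge0 hy0 d_gt0 hG1 hG2.
have := beta_sq_le1 hy0 d_gt0 hG1 hG2.
rewrite -pg1E -pg2E -ph1E -ph2E -y1E -ym1E -y2E => b_le1 perp mean psum.
move=> pg1_gt0 pg2_gt0 ph1_gt0 ph2_gt0.
have ratio : (xh1 - xh2) / (xg1 - xg2) = 3 * delta / xg2.
  by rewrite y1E ym1E y2E /xg1; field; rewrite ?oppr_eq0 y3_neq0.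
have ratio_ge0 : 0 <= 3 * delta / xg2 by rewrite y1E divr_ge0 //; lra.
have betaE : beta ^+ 2 = ph1 * ph2 / (pg1 * pg2) * (3 * delta / xg2) ^+ 2.
  by rewrite /beta ratio exprMn sqr_sqrtr // divr_ge0 // mulr_ge0 // ltW.
split.
  (* As [beta] is nonnegative, it suffices to bound its square. *)
  rewrite -(@expr_le1 _ 2) // ?betaE //.
  by rewrite /beta ratio mulr_ge0 ?sqrtr_ge0.
move=> g1 g2 h1 h2 os v v1 w w1 Eh alpha ab U.
(* The [g1] term vanishes because [xg1] is 0. *)
rewrite rmorph0 scale0r add0r.
apply: two_to_two_move => //; rewrite ?mean ?(ltW d_gt0) ?y1E //.
by rewrite -y1E -/beta betaE.
Qed.
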